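(* Let $N\ge2$ and let $a:\mathbb{R}^N\to(0,\infty)$ be continuous, $\mathbb{Z}^N$-periodic (i.e. $a(x+ke_i)=a(x)$ for all $x\in\mathbb{R}^N$, $k\in\mathbb{Z}$, $i=1,\dots,N$), with $\theta\le a(x)\le\Theta$ for all $x\in\mathbb{R}^N$, where $0<\theta<\Theta$. For each $\nu\in\mathbb{S}^{N-1}$ there exists a unique $c(\nu)\in[\sqrt\theta,\sqrt\Theta]$ such that for all compact $K\subseteq\mathbb{R}^N$, $$\lim_{T\to\infty}\sup_{x\in K}\Big|\frac1T h_\nu(Tx)-c(\nu)(x\cdot\nu)\Big|=0,$$ and $c(\nu)=c(-\nu)$.
   Context: $\{e_1,\dots,e_N\}$ is the standard basis of $\mathbb{R}^N$ and $\Sigma_\nu=\{x\in\mathbb{R}^N:x\cdot\nu=0\}$. For $y_0,y_1\in\mathbb{R}^N$, $d_{\sqrt a}(y_0,y_1):=\inf_\gamma\int_0^1\sqrt{a(\gamma(t))}\,|\dot\gamma(t)|\,dt$, where the infimum is over Lipschitz curves $\gamma:[0,1]\to\mathbb{R}^N$ with $\gamma(0)=y_0$, $\gamma(1)=y_1$. The signed distance function to $\Sigma_\nu$ is $h_\nu(y):=\mathrm{sign}(y\cdot\nu)\inf_{z\in\Sigma_\nu}d_{\sqrt a}(y,z)$. *)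

(* Defs.v *)
From mathcomp Require Import all_boot all_order all_algebra.
From mathcomp Require Import all_classical all_reals all_analysis.
Set Implicit Arguments.
Unset Strict Implicit.
Unset Printing Implicit Defensive.
Import Order.TTheory GRing.Theory Num.Theory.
Import numFieldNormedType.Exports.
Local Open Scope classical_set_scope.
Local Open Scope ring_scope.

Section Definitions.
Context {R : realType} {N : nat}.
Implicit Types (a : 'rV[R]_N -> R) (x y z nu : 'rV[R]_N) (g : R -> 'rV[R]_N).

Definition dot x y : R := \sum_(i < N) x 0 i * y 0 i.

(* The library norm `|x| on 'rV[R]_N is the sup norm, hence this definition.
   The two norms induce the same topology, the same Lipschitz curves and the
   same derivatives. *)
Definition enorm x : R := Num.sqrt (dot x x).

Definition unit_sphere : set 'rV[R]_N := [set x | enorm x = 1].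

Definition hyperplane nu : set 'rV[R]_N := [set x | dot x nu = 0].

Definition Zperiodic a : Prop :=
  forall x (k : int) (i : 'I_N), a (x + k%:~R *: delta_mx 0 i) = a x.

(* Curves are functions on R of which only the restriction to [0, 1] matters:
   the integrand depends on g outside [0, 1] only at t = 0 and t = 1, and
   where g is not differentiable, a null set, derive1 g t takes a default value. *)
Definition lipschitz_curve y0 y1 : set (R -> 'rV[R]_N) :=
  [set g | [/\ [lipschitz g t | t in (`[0, 1] : set R)], g 0 = y0 & g 1 = y1]].

Definition sqrt_length a g : R :=
  \int[lebesgue_measure]_(t in `[0, 1])
    (Num.sqrt (a (g t)) * enorm (derive1 g t)).

Definition sqrt_dist a y0 y1 : R :=
  inf [set sqrt_length a g | g in lipschitz_curve y0 y1].

Definition signed_dist a nu y : R :=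
  Num.sg (dot y nu) * inf [set sqrt_dist a y z | z in hyperplane nu].

Definition planar_limit a nu (c : R) : Prop :=
  forall K : set 'rV[R]_N, compact K ->
    sup [set `|T^-1 * signed_dist a nu (T *: x) - c * dot x nu| | x in K]
      @[T --> +oo] --> 0.

End Definitions.

(* Main.v *)
(* Let d be the distance of the metric sqrt a. It is a metric, invariant under
   integer translations and comparable to the Euclidean one, so for all y and w
   the numbers d(y, y + w) and d(0, w) differ by at most a constant C (move y to
   a nearby lattice point). Hence G(s) := inf {d(0, w) | w . nu = s} satisfies
   G(s + t) <= G(s) + G(t) + C, and is within a constant of the distance to the
   hyperplane of any point y with |y . nu| = |s|. By Fekete's lemma G(s) / s
   converges; the limit is c(nu).

   That d >= sqrt theta |.| and that d is a metric need lengths to behave well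
   for every Lipschitz curve, i.e. Rademacher's theorem in dimension one. For f
   Lipschitz with constant L, G(x) = (f(x) / L + x) / 2 is nondecreasing, and so
   is x - G(x); the Stieltjes measure of G is thus dominated by the Lebesgue
   measure, and the Lebesgue differentiation theorem applied to its
   Radon-Nikodym density gives the derivative of f almost everywhere. *)
From HB Require Import structures.
Require Import Defs.
From mathcomp Require Import all_boot all_order all_algebra.
From mathcomp Require Import all_classical all_reals all_analysis.
From mathcomp Require Import measurable_realfun ring lra.
Import Order.TTheory GRing.Theory Num.Theory.
Import numFieldNormedType.Exports.
Local Open Scope classical_set_scope.
Local Open Scope ring_scope.

Set Implicit Arguments.
Unset Strict Implicit.
Unset Printing Implicit Defensive.

(** * One-dimensional Rademacher theorem for Lipschitz functions *)

Definition clamp {R : realType} (x : R) : R := Num.min 1 (Num.max 0 x).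

Lemma clamp_itv (R : realType) (x : R) : clamp x \in `[0, 1]%R.
Proof.
rewrite in_itv/= /clamp minEle maxEle.
by repeat case: ifPn; rewrite -?ltNge => *; lra.
Qed.

Lemma clamp_id (R : realType) (x : R) : x \in `[0, 1]%R -> clamp x = x.
Proof.
rewrite in_itv/= /clamp => /andP[x0 x1]; rewrite (max_idPr x0).
by apply/min_idPr.
Qed.

Lemma clamp_mono (R : realType) (x y : R) : x <= y ->
  0 <= clamp y - clamp x <= y - x.
Proof.
rewrite /clamp => xy.
by rewrite !minEle !maxEle; repeat case: ifPn; rewrite -?ltNge => *; lra.
Qed.

Lemma clamp_contract (R : realType) (x y : R) :
  `|clamp x - clamp y| <= `|x - y|.
Proof.
wlog xy : x y / x <= y.
  move=> H; have [/H//|/ltW/H] := leP x y.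
  by rewrite distrC (distrC y).
have /andP[c0 c1] := clamp_mono xy.
by rewrite distrC ger0_norm// distrC ger0_norm// (le_trans c0).
Qed.

Lemma measurable_unit_itv (R : realType) :
  measurable (`[0, 1]%classic : set (measurableTypeR R)).
Proof. exact: measurable_itv. Qed.

Lemma lebesgue_stieltjes_measure_oc (R : realType) (G : cumulative R R)
    (a b : R) : a <= b ->
  lebesgue_stieltjes_measure G `]a, b]%classic = (G b - G a)%:E.
Proof.
move=> ab; rewrite /lebesgue_stieltjes_measure /measure_extension/=.
rewrite measurable_mu_extE/=; last exact: is_ocitv.
by rewrite wlength_itv_bnd.
Qed.

(* If both [G] and [x - G x] are nondecreasing, their Stieltjes measures add up
   to the Lebesgue measure, which therefore dominates that of [G]. *)
Lemma le_lebesgue_stieltjes_measure (R : realType) (G : R -> R) :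
  (forall x y, x <= y -> 0 <= G y - G x <= y - x) ->
  exists2 m : {measure set (measurableTypeR R) -> \bar R},
    (forall a b, a <= b -> m `]a, b]%classic = (G b - G a)%:E) &
    forall A, measurable A -> (m A <= lebesgue_measure A)%E.
Proof.
move=> HG.
pose H x := x - G x.
have HH x y : x <= y -> 0 <= H y - H x <= y - x.
  by move=> xy; have := HG _ _ xy; rewrite /H; lra.
have cum (F : R -> R) : (forall x y, x <= y -> 0 <= F y - F x <= y - x) ->
    exists F' : cumulative R R, F' = F :> (R -> R).
  move=> HF.
  have nd : nondecreasing F by move=> x y xy; have := HF _ _ xy; lra.
  have cF : continuous F.
    move=> x; apply/cvgrPdist_lt => e e0.
    apply/nbhs_ballP; exists e => //= t; rewrite /ball/= !ltr_norml => xt.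
    have [/HF|/ltW/HF] := leP x t; lra.
  have rc := right_continuousW cF.
  pose i := isCumulative.Build R _ R F nd rc.
  by exists (HB.pack_for (cumulative R R) F i).
have [G' GE] := cum _ HG; have [H' HE] := cum _ HH.
pose mG := lebesgue_stieltjes_measure G'.
pose mH := lebesgue_stieltjes_measure H'.
have mGE a b : a <= b -> mG `]a, b]%classic = (G b - G a)%:E.
  by rewrite -GE; exact: lebesgue_stieltjes_measure_oc.
have mHE a b : a <= b -> mH `]a, b]%classic = (H b - H a)%:E.
  by rewrite -HE; exact: lebesgue_stieltjes_measure_oc.
exists mG => // A mA.
pose mGH : {measure set (measurableTypeR R) -> \bar R} := measure_add mG mH.
have mGHE X : mGH X = (mG X + mH X)%E by exact: measure_addE.
suff -> : lebesgue_measure A = mGH A by rewrite mGHE leeDl.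
apply: lebesgue_measure_unique => // X /ocitvP[->|[[a b]/= ab ->]].
  by rewrite !measure0.
rewrite mGHE (mGE _ _ (ltW ab)) (mHE _ _ (ltW ab)).
rewrite lebesgue_measure_itv/= lte_fin ab -!EFinD /H; congr EFin; ring.
Qed.

(** On the unit interval [f x = L * (2 * G x - x)], so the derivative is [L * (2 * r - 1)], where
    [r] is the density of the Stieltjes measure of [G]. A total measurable [phi] is produced instead
    of [derive1 f], so that it can be integrated freely. *)
Lemma lipschitz_derive_ae (R : realType) (f : R -> R) (L : R) : 0 < L ->
  (forall x y : R, x \in `[0, 1]%R -> y \in `[0, 1]%R ->
     `|f x - f y| <= L * `|x - y|) ->
  exists phi : R -> R,
    [/\ measurable_fun setT phi,
        lebesgue_measure.-integrable `[0, 1] (EFin \o phi),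
        {ae lebesgue_measure,
          forall x : R, 0 < x < 1 -> is_derive x 1 f (phi x)} &
        \int[lebesgue_measure]_(x in `[0, 1]) phi x = f 1 - f 0].
Proof.
move=> L0 lf.
(* Precomposing with [clamp] gives the slope bounds for [G] on the whole line, although [f] is
   controlled only on the unit interval. *)
pose G x := (f (clamp x) / L + x) / 2.
have HG x y : x <= y -> 0 <= G y - G x <= y - x.
  move=> xy; have := lf _ _ (clamp_itv y) (clamp_itv x).
  have := clamp_mono xy => cxy.
  have -> : `|clamp y - clamp x| = clamp y - clamp x by rewrite ger0_norm; lra.
  rewrite ler_norml => ff.
  have -> : G y - G x = ((f (clamp y) - f (clamp x)) / L + (y - x)) / 2.
    by rewrite /G; field; rewrite gt_eqF.
  have : - (clamp y - clamp x) <= (f (clamp y) - f (clamp x)) / L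
         <= clamp y - clamp x.
    by rewrite ler_pdivlMr// ler_pdivrMr//; lra.
  lra.
have [m mG mle] := le_lebesgue_stieltjes_measure HG.
have mD : measurable (`]0, 1]%classic : set (measurableTypeR R)).
  exact: measurable_itv.
have mDoo : (m `]0%R, 1%R]%classic < +oo)%E by rewrite mG ?ltry.
(* Restriction to []0, 1]] gives a finite measure, to which Radon-Nikodym is applied. *)
pose nu : {finite_measure set (measurableTypeR R) -> \bar R} := mfrestr mD mDoo.
have nuE A : nu A = m (A `&` `]0, 1]%classic) by [].
have nul : nu `<< (@lebesgue_measure R).
  apply/null_content_dominatesP => A mA A0.
  apply/eqP; rewrite eq_le measure_ge0 andbT nuE.
  rewrite (le_trans (mle _ (measurableI _ _ mA mD)))//.
  rewrite -A0 le_measure// ?inE//; exact: measurableI.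
have [psi [_ psifin intpsi psiE]] := radon_nikodym_sigma_finite nul.
pose r : R -> R := fun x => fine (psi x).
have rE : EFin \o r = psi by apply/funext => x /=; rewrite fineK.
have intr : lebesgue_measure.-integrable (setT : set R) (EFin \o r) by rewrite rE.
have intS (A : set R) : measurable A -> lebesgue_measure.-integrable A (EFin \o r).
  by move=> mA; apply: integrableS intr.
have FE (x : R) : x \in `[0, 1]%R ->
    \int[lebesgue_measure]_(t in `]0, x]) r t = G x - G 0.
  rewrite in_itv/= => /andP[x0 x1].
  have -> : \int[lebesgue_measure]_(t in `]0, x]) r t = fine (nu `]0, x]%classic).
    by rewrite psiE; [rewrite -rE|exact: measurable_itv].
  rewrite nuE setIidl ?mG//.
  by apply: subset_itvl; rewrite bnd_simp.
have mr : measurable_fun setT r.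
  by apply/measurable_EFinP; exact: measurable_int intr.
have m01 := @measurable_unit_itv R.
pose mu := @lebesgue_measure R.
have int1 : mu.-integrable `[0, 1] (EFin \o cst (1 : R)).
  apply: measurable_bounded_integrable => //=.
    by rewrite lebesgue_measure_itv/=; case: ifPn => // _; rewrite -EFinB ltry.
  exact: bounded_cst.
have int2r : mu.-integrable `[0, 1] (EFin \o (fun x => 2 * r x)).
  exact: (integrableZl m01 2 (intS _ m01)).
have int2r1 : mu.-integrable `[0, 1] (EFin \o (fun x => 2 * r x - 1)).
  exact: (integrableB m01 int2r int1).
exists (fun x => L * (2 * r x - 1)); split.
- apply: measurable_funM => //; apply: measurable_funB => //.
  by apply: measurable_funM => //.
- exact: (integrableZl m01 L int2r1).
(* Lebesgue differentiation: at almost every [x] the primitive of [r] has derivative [r x]. *)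
- have := @FTC1 R r (BRight 0) (fun y => intS _ (measurable_itv _))
    (open_integrable_locally openT intr).
  apply: filterS; first exact: (ae_filter_ringOfSetsType lebesgue_measure).
  move=> x /= + /andP[x0 x1] => -[//|dF Fx].
  pose F x := \int[lebesgue_measure]_(t in `]0, x]) r t.
  have dF' : is_derive x (1 : R) F (r x).
    by apply: DeriveDef => //; rewrite -Fx derive1E.
  have df' : is_derive x (1 : R) (fun t => L * (2 * (F t + G 0) - t))
                                 (L * (2 * r x - 1)).
    by apply: is_derive_eq; rewrite addr0 !scaler_nat; rewrite mulr_natl.
  (* Near [x] one stays inside the unit interval, where [F t + G 0 = G t] and [clamp t = t], so the
     function just differentiated is [f]. *)
  apply: near_eq_is_derive df'; near=> t.
  have : t \in `]0, 1[%R by near: t; apply: near_in_itvoo; rewrite in_itv/= x0.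
  rewrite in_itv/= => /andP[t0 t1].
  have t01 : t \in `[0, 1]%R by rewrite in_itv/= !ltW.
  rewrite /F FE// /G clamp_id//; field; lra.
- rewrite RintegralZl// RintegralB// RintegralZl//; last exact: intS.
  rewrite -Rintegral_itv_obnd_cbnd; last exact: intS.
  rewrite FE ?in_itv/= ?lexx ?ler01// Rintegral_cst//= lebesgue_measure_itv/=.
  rewrite lte_fin ltr01 /= /G !clamp_id ?in_itv/= ?lexx ?ler01//; field; lra.
Unshelve. all: by end_near. Qed.

(** * Integrals of functions not known to be measurable *)

Section nonmeasurable_integrand.
Context d (T : measurableType d) (R : realType).
Variable mu : {measure set T -> \bar R}.
Local Open Scope ereal_scope.
Import HBNNSimple.

(** The integral of a nonnegative function is a supremum over the simple functions below it, and
    this family grows with the function. *)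
Lemma ge0_integral_mono (f g : T -> \bar R) :
  (forall x, 0 <= f x) -> (forall x, f x <= g x) ->
  \int[mu]_x f x <= \int[mu]_x g x.
Proof.
move=> f0 fg; have g0 x : 0 <= g x by exact: le_trans (fg x).
rewrite (ge0_integralTE _ f0) (ge0_integralTE _ g0).
by apply: ereal_sup_le => _ [h /= hf <-]; exists h => //= x; exact: le_trans (fg x).
Qed.

(* [f] need not be measurable: its integral, a supremum over simple functions
   below [f], is unaffected by changes on a null set. *)
Lemma ge0_ae_eq_integral (D : set T) (f g : T -> \bar R) : measurable D ->
  (forall x, 0 <= f x) -> (forall x, 0 <= g x) -> measurable_fun D g ->
  {ae mu, forall x, D x -> f x = g x} ->
  \int[mu]_(x in D) f x = \int[mu]_(x in D) g x.
Proof.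
move=> mD f0 g0 mg [N [mN N0 fgN]].
rewrite [LHS]integral_mkcond [RHS]integral_mkcond.
have r0 (h : T -> \bar R) x : (forall x, 0 <= h x) -> 0 <= (h \_ D) x.
  by move=> h0; rewrite patchE; case: ifP.
have mgD : measurable_fun setT (g \_ D) by apply/(measurable_restrictT _ mD).
have fgE x : ~ N x -> (f \_ D) x = (g \_ D) x.
  move=> Nx; rewrite !patchE; case: ifPn => // /set_mem Dx.
  by apply: contrapT => fg; apply/Nx/fgN => /= /(_ Dx).
apply/eqP; rewrite eq_le; apply/andP; split.
  rewrite ge0_integralTE; last by move=> x; exact: r0.
  (* A simple function below [f] on [D] lies below [g] off the null set [N]. *)
  apply: ge_ereal_sup => _ [h /= hf <-]; rewrite -integralT_nnsfun.
  apply: ae_ge0_le_integral => //.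
  - by move=> x _; rewrite lee_fin.
  - exact/measurable_EFinP.
  - by move=> x _; exact: r0.
  - exists N; split => // x /= hx; apply: contrapT => Nx; apply: hx => _.
    by rewrite -fgE.
(* Setting [g] to 0 on [N] keeps its integral and puts it below [f] everywhere on [D]. *)
rewrite (@ae_eq_integral _ _ _ mu setT ((g \_ D) \_ (~` N)))//.
- apply: ge0_integral_mono => x.
    by rewrite patchE; case: ifP => // _; exact: r0.
  rewrite [leLHS]patchE; case: ifPn => [/set_mem Nx|_]; last exact: r0.
  by rewrite fgE.
- apply/(measurable_restrictT _ (measurableC mN)).
  exact: measurable_funS mgD.
- exists N; split => // x /= hx; apply: contrapT => Nx; apply: hx => _.
  by rewrite [RHS]patchE mem_set.
Qed.
End nonmeasurable_integrand.

(** * Lebesgue measure under affine maps of the line *)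

Section affine_change_of_variables.
Context {R : realType}.
Variables (s t : R).
Hypothesis s0 : s != 0.
Let mu := @lebesgue_measure R.
Let phi (x : R) : R := s * x + t.

Lemma measurable_affine :
  measurable_fun (setT : set (measurableTypeR R)) (phi : _ -> measurableTypeR R).
Proof.
apply: measurable_funD; last exact: measurable_cst.
by apply: measurable_funM; [exact: measurable_cst|exact: measurable_id].
Qed.

(** The right-hand side is a measure that agrees with length on half-open intervals, and such a
    measure is unique. *)
Lemma lebesgue_measure_affine (A : set (measurableTypeR R)) : measurable A ->
  mu A = (`|s|%:E * pushforward mu (phi : _ -> measurableTypeR R) A)%E.
Proof.
move=> mA.
have [m mE] : exists m : {measure set (measurableTypeR R) -> \bar R},
    forall A, m A = mu (phi @^-1` A).
  unshelve eexists (pushforward mu (phi : _ -> measurableTypeR R)) => //.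
  exact: measurable_affine.
pose m' : {measure set (measurableTypeR R) -> \bar R} :=
  mscale (NngNum (normr_ge0 s)) m.
have m'E B : m' B = (`|s|%:E * mu (phi @^-1` B))%E by rewrite -mE.
rewrite -m'E; apply: lebesgue_measure_unique => // X /ocitvP[->|[[a b]/= ab ->]].
  by rewrite !measure0.
rewrite m'E [LHS]lebesgue_measure_itv/= lte_fin ab.
have [s1|s1] : s < 0 \/ 0 < s by case: ltgtP s0 => // *; [left|right].
(* A negative factor reverses orientation, so the preimage is closed on the left and open on the
   right. *)
- have -> : phi @^-1` `]a, b] = `[(b - t) / s, (a - t) / s[%classic.
    apply/seteqP; split => x /=; rewrite !in_itv/= /phi.
      by rewrite ler_ndivrMr// ltr_ndivlMr// [x * s]mulrC => /andP[? ?]; lra.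
    by rewrite ler_ndivrMr// ltr_ndivlMr// [x * s]mulrC => /andP[? ?]; lra.
  rewrite [X in (_ * X)%E]lebesgue_measure_itv/= lte_fin.
  rewrite ltr_ndivrMr// divfK ?lt_eqF// ifT; last lra.
  by rewrite -!EFinD -EFinM ltr0_norm//; congr EFin; field.
- have -> : phi @^-1` `]a, b] = `](a - t) / s, (b - t) / s]%classic.
    apply/seteqP; split => x /=; rewrite !in_itv/= /phi.
      by rewrite ltr_pdivrMr// ler_pdivlMr// [x * s]mulrC => /andP[? ?]; lra.
    by rewrite ltr_pdivrMr// ler_pdivlMr// [x * s]mulrC => /andP[? ?]; lra.
  rewrite [X in (_ * X)%E]lebesgue_measure_itv/= lte_fin.
  rewrite ltr_pdivrMr// divfK ?gt_eqF// ifT; last lra.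
  by rewrite -!EFinD -EFinM gtr0_norm//; congr EFin; field.
Qed.

Lemma ge0_integral_affine (f : R -> \bar R) : measurable_fun setT f ->
  (forall x, 0 <= f x)%E ->
  (\int[mu]_x f x = `|s|%:E * \int[mu]_x f (s * x + t)%R)%E.
Proof.
move=> mf f0.
have <- : (\int[pushforward mu (phi : _ -> measurableTypeR R)]_x f x =
           \int[mu]_x f (s * x + t)%R)%E.
  by rewrite (ge0_integral_pushforward measurable_affine).
rewrite -(ge0_integral_mscale _ _ (NngNum (normr_ge0 s)))//.
  exact: measurable_affine.
move=> mphi; apply: eq_measure_integral => // A mA _; exact: lebesgue_measure_affine.
Qed.

Lemma ae_affine (P : R -> Prop) : {ae mu, forall x, P x} ->
  {ae mu, forall x, P (s * x + t)}.
Proof.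
move=> [N [mN N0 PN]]; exists (phi @^-1` N); split.
- by rewrite -[X in measurable X]setTI; exact: measurable_affine.
- have := lebesgue_measure_affine mN; rewrite N0 => /esym/eqP.
  by rewrite mule_eq0 eqe normr_eq0 (negbTE s0)/= => /eqP.
- by move=> x /= Px; exact: PN.
Qed.

End affine_change_of_variables.

(** * Euclidean inner product and norm *)

Section euclidean_norm.
Context {R : realType} {N : nat}.
Implicit Types x y z : 'rV[R]_N.

Lemma dotC x y : dot x y = dot y x.
Proof. by apply: eq_bigr => i _; rewrite mulrC. Qed.

Lemma dotDl x y z : dot (x + y) z = dot x z + dot y z.
Proof. by rewrite /dot -big_split; apply: eq_bigr => i _; rewrite mxE mulrDl. Qed.

Lemma dotZl k x y : dot (k *: x) y = k * dot x y.
Proof. by rewrite /dot big_distrr; apply: eq_bigr => i _; rewrite mxE /= mulrA. Qed.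

Lemma dotNl x y : dot (- x) y = - dot x y.
Proof. by rewrite -scaleN1r dotZl mulN1r. Qed.

Lemma dotNr x y : dot x (- y) = - dot x y.
Proof. by rewrite dotC dotNl dotC. Qed.

Lemma dotBl x y z : dot (x - y) z = dot x z - dot y z.
Proof. by rewrite dotDl dotNl. Qed.

Lemma dot_ge0 x : 0 <= dot x x.
Proof. by apply: sumr_ge0 => i _; rewrite -expr2 sqr_ge0. Qed.

Lemma enorm_ge0 x : 0 <= enorm x.
Proof. exact: sqrtr_ge0. Qed.

Lemma sqr_enorm x : enorm x ^+ 2 = dot x x.
Proof. by rewrite sqr_sqrtr ?dot_ge0. Qed.

Lemma enormZ k x : enorm (k *: x) = `|k| * enorm x.
Proof.
rewrite /enorm dotZl dotC dotZl mulrA -expr2 sqrtrM ?sqr_ge0//.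
by rewrite sqrtr_sqr.
Qed.

Lemma enormN x : enorm (- x) = enorm x.
Proof. by rewrite -scaleN1r enormZ normrN1 mul1r. Qed.

(** Cauchy-Schwarz, from the nonnegative square of the vector [(y.y) x - (x.y) y]. *)
Lemma dot_le_enorm x y : dot x y <= enorm x * enorm y.
Proof.
have [y0|y0] := eqVneq (dot y y) 0.
  rewrite /dot big1 ?mulr_ge0 ?enorm_ge0// => i _.
  have y2 j : true -> 0 <= y 0 j * y 0 j by rewrite -expr2 sqr_ge0.
  have /eqP := @psumr_eq0P _ _ _ _ y2 y0 i isT.
  by rewrite mulf_eq0 orbb => /eqP ->; rewrite mulr0.
have {}y0 : 0 < dot y y by rewrite lt_neqAle eq_sym y0 dot_ge0.
rewrite /enorm -sqrtrM ?dot_ge0//.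
have [xy|xy] := leP (dot x y) 0; first by rewrite (le_trans xy)// sqrtr_ge0.
rewrite -[leLHS](ger0_norm (ltW xy)) -sqrtr_sqr ler_sqrt ?mulr_ge0 ?dot_ge0//.
have := dot_ge0 (dot y y *: x - dot x y *: y).
rewrite dotBl !(dotC _ (_ - _)) !dotBl !dotZl !(dotC _ (_ *: _)) !dotZl (dotC y x).
move=> H; rewrite -(ler_pM2l y0); nra.
Qed.

Lemma ler_norm_dot x y : `|dot x y| <= enorm x * enorm y.
Proof.
rewrite ler_norml dot_le_enorm andbT lerNl -dotNl -(enormN x).
exact: dot_le_enorm.
Qed.

Lemma enorm_le_sum x : enorm x <= \sum_(i < N) `|x 0 i|.
Proof.
have s0 : 0 <= \sum_(i < N) `|x 0 i| by apply: sumr_ge0.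
rewrite -[leRHS]ger0_norm// -sqrtr_sqr ler_sqrt ?sqr_ge0// expr2 big_distrl/=.
apply: ler_sum => i _; rewrite -expr2 -[leLHS]ger0_norm ?sqr_ge0// normrX expr2.
rewrite ler_wpM2l// (bigD1 i)//= lerDl; exact: sumr_ge0.
Qed.

End euclidean_norm.

(** * Lipschitz curves and measurable speeds *)

Section curves.
Context {R : realType} {N : nat}.
Implicit Types (g : R -> 'rV[R]_N) (y z : 'rV[R]_N) (a : 'rV[R]_N -> R).
Let mu := @lebesgue_measure R.

Lemma ler_entry_norm y (i : 'I_N) : `|y 0 i| <= `|y|.
Proof.
rewrite [leRHS]/Num.Def.normr/= mx_normrE.
exact: (le_bigmax _ (fun k : 'I_1 * 'I_N => `|y k.1 k.2|) (0, i)).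
Qed.

Lemma lipschitz_curve_bound y z g : lipschitz_curve y z g ->
  exists2 M, 0 < M & forall s t : R, s \in `[0, 1]%R -> t \in `[0, 1]%R ->
    `|g s - g t| <= M * `|s - t|.
Proof.
case=> -[M [_ HM]] _ _; exists (`|M| + 1); first by rewrite ltr_wpDl.
move=> s t s01 t01.
have := HM (`|M| + 1).
rewrite (le_lt_trans (ler_norm M)) ?ltrDl// => /(_ isT (s, t)).
by apply; split.
Qed.

Lemma bound_lipschitz_curve (M : R) g :
  (forall s t : R, s \in `[0, 1]%R -> t \in `[0, 1]%R ->
    `|g s - g t| <= M * `|s - t|) -> lipschitz_curve (g 0) (g 1) g.
Proof.
move=> H; split => //; exists M; split; first exact: num_real.
move=> K MK [s t] /= [s01 t01]; apply: (le_trans (H _ _ s01 t01)).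
by rewrite ler_wpM2r// ltW.
Qed.

Definition is_speed a g (f : R -> R) : Prop :=
  [/\ measurable_fun setT f, forall t, 0 <= f t,
      mu.-integrable `[0, 1] (EFin \o f) &
      {ae mu, forall t : R, 0 < t < 1 ->
        exists2 v, is_derive t (1 : R) g v &
                   f t = Num.sqrt (a (g t)) * enorm v}].

Lemma is_derive_rowP g (t : R) v :
  is_derive t (1 : R) g v <->
  forall i, is_derive t (1 : R) (fun s => g s 0 i) (v 0 i).
Proof.
split=> [[dg <-] i|H].
  apply: DeriveDef; first exact: ((derivable_mxP _ _ _).1 dg).
  by rewrite derive_mx// mxE.
have dg : derivable g t 1.
  by apply/derivable_mxP => i j; rewrite (ord1 i); have [] := H j.
apply: DeriveDef => //; rewrite derive_mx//; apply/rowP => j; rewrite mxE.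
by have [] := H j.
Qed.

Lemma ae_neq (x : R) : {ae mu, forall t, t != x}.
Proof.
exists [set x]; split => //; first exact: lebesgue_measure_set1.
by move=> t /= /negP/negPn/eqP.
Qed.

(** The endpoints are put into the exceptional null set, because the two-sided derivative there
    depends on [g] outside the unit interval. *)
Lemma sqrt_lengthE a g f : is_speed a g f ->
  sqrt_length a g = \int[mu]_(t in `[0, 1]) f t.
Proof.
move=> [mf f0 _ gf]; rewrite /sqrt_length /Rintegral; congr fine.
apply: ge0_ae_eq_integral => //.
- by move=> t; rewrite lee_fin mulr_ge0// ?sqrtr_ge0// enorm_ge0.
- by apply/measurable_EFinP; exact: measurable_funS mf.
have ? := ae_filter_ringOfSetsType mu.
apply: filterS3 (ae_neq 0) (ae_neq 1) gf.
move=> t t0 t1 H; rewrite /= in_itv/= => /andP[t0' t1'].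
have [|v [_ dv] ->] := H; first by rewrite !lt_neqAle t0' t1' eq_sym t0 t1.
by rewrite derive1E dv.
Qed.

Lemma sqrt_length_ge0 a g : 0 <= sqrt_length a g.
Proof.
by apply: Rintegral_ge0 => t _; rewrite mulr_ge0// ?sqrtr_ge0// enorm_ge0.
Qed.

End curves.

(** * Existence of speeds and the lower bound on length *)

Section speed_of_lipschitz_curves.
Context {R : realType} {N : nat}.
Variables (a : 'rV[R]_N -> R) (theta Theta : R).
Hypotheses (theta0 : 0 < theta) (ca : continuous a)
  (a_bnd : forall x, theta <= a x <= Theta).
Implicit Types (g : R -> 'rV[R]_N) (y z : 'rV[R]_N).
Let mu := @lebesgue_measure R.

Let sqrt_bnd x : Num.sqrt theta <= Num.sqrt (a x) <= Num.sqrt Theta.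
Proof.
have /andP[ax1 ax2] := a_bnd x.
by rewrite !ler_sqrt// ?ax1// (le_trans (ltW theta0))// (le_trans ax1).
Qed.

Lemma measurable_sqrt_comp g M : (forall s t, `|g s - g t| <= M * `|s - t|) ->
  measurable_fun (setT : set R) (fun t => Num.sqrt (a (g t))).
Proof.
move=> gM; apply: continuous_measurable_fun => t.
apply: continuous_comp; last exact: sqrt_continuous.
apply: continuous_comp; last exact: ca.
have M0 : 0 <= M.
  by have := gM 1 0; rewrite subr0 normr1 mulr1; apply: le_trans.
apply/cvgrPdist_lt => e e0; apply/nbhs_ballP.
exists (e / (M + 1)); first by rewrite /= divr_gt0// ltr_wpDl.
move=> s; rewrite /ball/= ltr_pdivlMr ?ltr_wpDl// mulrC => st.
apply: le_lt_trans st; rewrite (le_trans (gM _ _))//.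
by rewrite ler_wpM2r// lerDl.
Qed.

Lemma measurable_enorm (v : R -> 'rV[R]_N) :
  (forall i, measurable_fun (setT : set R) (fun t => v t 0 i)) ->
  measurable_fun (setT : set R) (fun t => enorm (v t)).
Proof.
move=> mv; apply: (measurableT_comp (continuous_measurable_fun (@sqrt_continuous R))).
by apply: measurable_sum => i; exact: measurable_funM.
Qed.

(** The velocity [v] is assembled from the almost everywhere derivatives of the coordinates. With
    [w = z - y], the integral of [w.v] is [w.w], and Cauchy-Schwarz bounds [w.v] by [|w| |v|], which
    gives the lower bound. *)
Lemma lipschitz_curve_speed y z g : lipschitz_curve y z g ->
  exists2 f, is_speed a g f &
    Num.sqrt theta * enorm (z - y) <= \int[mu]_(t in `[0, 1]) f t.
Proof.
move=> lg; have [M M0 HM] := lipschitz_curve_bound lg.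
have [_ g0 g1] := lg.
have gi (i : 'I_N) (s t : R) : s \in `[0, 1]%R -> t \in `[0, 1]%R ->
    `|g s 0 i - g t 0 i| <= M * `|s - t|.
  move=> s01 t01; apply: le_trans (HM _ _ s01 t01).
  by have := ler_entry_norm (g s - g t) i; rewrite !mxE.
have [phi Hphi] := choice (fun i => lipschitz_derive_ae M0 (gi i)).
pose v t : 'rV[R]_N := \row_i phi i t.
have mv : measurable_fun (setT : set R) (fun t => enorm (v t)).
  apply: measurable_enorm => i; have [mphi _ _ _] := Hphi i.
  apply: eq_measurable_fun mphi.
  by move=> t _; rewrite mxE.
(* With [clamp] the first factor is continuous, hence measurable, on the whole line. *)
pose f t := Num.sqrt (a (g (clamp t))) * enorm (v t).
have mf : measurable_fun setT f.
  apply: measurable_funM => //; apply: (@measurable_sqrt_comp _ M) => s t.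
  apply: (le_trans (HM _ _ (clamp_itv _) (clamp_itv _))).
  by rewrite (ler_wpM2l (ltW M0))// clamp_contract.
have f0 t : 0 <= f t by rewrite mulr_ge0 ?sqrtr_ge0 ?enorm_ge0.
have m01 := @measurable_unit_itv R.
have iphi i : mu.-integrable `[0, 1] (EFin \o phi i) by case: (Hphi i).
have intf : mu.-integrable `[0, 1] (EFin \o f).
  (* The dominating function is [sqrt Theta] times the sum of the absolute coordinate
     derivatives. *)
  have : mu.-integrable `[0, 1]
      (fun t => (Num.sqrt Theta)%:E * \sum_(i < N) `|(phi i t)%:E|)%E.
    apply: integrableZl => //; apply: integrable_sum => // i _.
    exact: (integrable_abse (iphi i)).
  apply: le_integrable => //.
    by apply/measurable_EFinP; exact: measurable_funS mf.
  move=> t _; rewrite sumEFin -EFinM !abse_EFin lee_fin ger0_norm//.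
  rewrite (le_trans _ (ler_norm _))//.
  rewrite ler_pM ?sqrtr_ge0 ?enorm_ge0//.
    by case/andP: (sqrt_bnd (g (clamp t))).
  rewrite (le_trans (enorm_le_sum _))//.
  by under eq_bigr do rewrite mxE.
exists f; first split => //.
  have ? := ae_filter_ringOfSetsType mu.
  have /filter_forall : forall i, {ae mu, forall t : R, 0 < t < 1 ->
      is_derive t (1 : R) (fun t => g t 0 i) (phi i t)}.
    by move=> i; case: (Hphi i).
  apply: filterS => t H t01.
  have cE : clamp t = t.
    by apply: clamp_id; rewrite in_itv/=; case/andP: t01 => *; rewrite !ltW.
  exists (v t); last by rewrite /f cE.
  by apply/is_derive_rowP => i; rewrite mxE; exact: H.
set w := z - y.
have [w0|w0] := eqVneq (enorm w) 0.
  by rewrite w0 mulr0; apply: Rintegral_ge0.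
have {}w0 : 0 < enorm w by rewrite lt_neqAle eq_sym w0 enorm_ge0.
(* [h] is [sqrt theta] times the component of the velocity along [w]; it lies below [f] and has
   exactly the required integral. *)
pose h t := Num.sqrt theta / enorm w * \sum_(i < N) w 0 i * phi i t.
have iwphi i : mu.-integrable `[0, 1] (EFin \o (fun t => w 0 i * phi i t)).
  exact: (integrableZl m01 (w 0 i) (iphi i)).
have inth : mu.-integrable `[0, 1]
    (EFin \o (fun t => \sum_(i < N) w 0 i * phi i t)).
  have := integrable_sum m01 (index_enum 'I_N) (fun i (_ : xpredT i) => iwphi i).
  by apply: eq_integrable => // t _; rewrite sumEFin.
have <- : \int[mu]_(t in `[0, 1]) h t = Num.sqrt theta * enorm w.
  rewrite RintegralZl//.
  suff -> : \int[mu]_(t in `[0, 1]) (\sum_(i < N) w 0 i * phi i t) = enorm w ^+ 2.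
    by rewrite expr2 mulrA divfK ?gt_eqF.
  rewrite sqr_enorm /Rintegral; under eq_integral do rewrite -sumEFin.
  rewrite integral_sum// -sum_fine; last first.
    by move=> i _; exact: (integrable_fin_num m01 (iwphi i)).
  apply: eq_bigr => i _; rewrite -[LHS]/(\int[mu]_(t in `[0, 1]) (w 0 i * phi i t)).
  rewrite RintegralZl//; congr (_ * _).
  by have [_ _ _ ->] := Hphi i; rewrite g0 g1 !mxE.
apply: le_Rintegral => //; first exact: (integrableZl m01 _ inth).
move=> t _; rewrite /h /f -mulrA.
have /andP[sq _] := sqrt_bnd (g (clamp t)).
apply: le_trans (ler_wpM2r (enorm_ge0 _) sq).
rewrite ler_wpM2l ?sqrtr_ge0// ler_pdivrMl//.
suff -> : \sum_(i < N) w 0 i * phi i t = dot w (v t) by exact: dot_le_enorm.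
by apply: eq_bigr => i _; rewrite [v t 0 i]mxE.
Qed.
End speed_of_lipschitz_curves.

(** * Reversal and concatenation of curves *)

Section curve_operations.
Context {R : realType} {N : nat}.
Variable a : 'rV[R]_N -> R.
Implicit Types (g h : R -> 'rV[R]_N) (y z : 'rV[R]_N).
Let mu := @lebesgue_measure R.

Lemma is_derive_affine g (s t x : R) v :
  is_derive (s * x + t) (1 : R) g v ->
  is_derive x (1 : R) (fun u => g (s * u + t)) (s *: v).
Proof.
move=> /is_derive_rowP dg; apply/is_derive_rowP => i; rewrite mxE mulrC.
apply: (@is_derive1_comp _ _ (fun u => s * u + t) _ _ _ (dg i)).
by apply: is_derive_eq; rewrite addr0 scaler1.
Qed.

Let m01 := @measurable_unit_itv R.

Lemma ge0_integrable_unit_itv (f : R -> R) : measurable_fun setT f ->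
  (forall t, 0 <= f t) -> (\int[mu]_(t in `[0%R, 1%R]) (f t)%:E < +oo)%E ->
  mu.-integrable `[0, 1] (EFin \o f).
Proof.
move=> mf f0 fi; apply/integrableP; split.
  by apply/measurable_EFinP; exact: measurable_funS mf.
by under eq_integral do rewrite /= ger0_norm//.
Qed.

Lemma integral_unit_reverse (f : R -> R) : measurable_fun setT f ->
  (forall t, 0 <= f t) ->
  (\int[mu]_(t in `[0%R, 1%R]) (f t)%:E =
   \int[mu]_(t in `[0%R, 1%R]) (f (-1 * t + 1)%R)%:E)%E.
Proof.
move=> mf f0.
rewrite integral_mkcond [RHS]integral_mkcond.
have n1 : -1 != 0 :> R by rewrite oppr_eq0 oner_eq0.
rewrite [LHS](ge0_integral_affine 1 n1).
- rewrite normrN1 mul1e; apply: eq_integral => t _; rewrite !patchE.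
  congr (if _ then _ else _); rewrite !mem_setE !in_itv/=.
  by apply/idP/idP => /andP[? ?]; apply/andP; split; lra.
- apply/(measurable_restrictT _ m01); apply/measurable_EFinP.
  exact: measurable_funS mf.
- by move=> t; rewrite patchE; case: ifP => // _; rewrite lee_fin.
Qed.

Lemma is_speed_reverse g f : is_speed a g f ->
  is_speed a (fun t => g (-1 * t + 1)) (fun t => f (-1 * t + 1)).
Proof.
move=> [mf f0 fi gf]; split => //.
- exact: (measurableT_comp mf (measurable_affine (-1) 1)).
- apply: ge0_integrable_unit_itv => //.
    exact: (measurableT_comp mf (measurable_affine (-1) 1)).
  rewrite -integral_unit_reverse//.
  exact: (integrable_lty m01 fi).
- have ? := ae_filter_ringOfSetsType mu.
  have n1 : -1 != 0 :> R by rewrite oppr_eq0 oner_eq0.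
  apply: filterS (ae_affine 1 n1 gf) => t H t01.
  have [|v dv ->] := H; first lra.
  exists (-1 *: v); first exact: is_derive_affine.
  by rewrite enormZ normrN1 mul1r.
Qed.

(** The summands [0] and [-1] keep both halves in the form [s * x + t] to which the affine change of
    variables applies. *)
Definition concat g h t := if t <= 2^-1 then g (2 * t + 0) else h (2 * t + -1).

(** Each half is run at double speed, and the factor 2 in [k] is cancelled by the change of
    variables. *)
Lemma is_speed_concat g h f e : is_speed a g f -> is_speed a h e ->
  exists2 k, is_speed a (concat g h) k &
    \int[mu]_(t in `[0, 1]) k t =
    \int[mu]_(t in `[0, 1]) f t + \int[mu]_(t in `[0, 1]) e t.
Proof.
move=> [mf f0 fi gf] [me e0 ei he].
pose k t := if t < 2^-1 then 2 * f (2 * t + 0) else 2 * e (2 * t + -1).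
have mk : measurable_fun (setT : set R) k.
  apply: measurable_fun_ifT.
  - exact: measurable_fun_ltr.
  - apply: measurable_funM => //.
    exact: (measurableT_comp mf (measurable_affine 2 0)).
  - apply: measurable_funM => //.
    exact: (measurableT_comp me (measurable_affine 2 (-1))).
have k0 t : 0 <= k t by rewrite /k; case: ifP => _; rewrite mulr_ge0.
have m01' : measurable (`[0, 1[%classic : set (measurableTypeR R)).
  exact: measurable_itv.
(* The interval of the first integral is half-open so that the two rescaled halves are disjoint: the
   time [1/2] belongs to the second. *)
have kE : (\int[mu]_(t in `[0%R, 1%R]) (k t)%:E =
    \int[mu]_(t in `[0%R, 1%R[) (f t)%:E + \int[mu]_(t in `[0%R, 1%R]) (e t)%:E)%E.
  rewrite integral_mkcond [X in (_ = X + _)%E]integral_mkcond.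
  rewrite [X in (_ = _ + X)%E]integral_mkcond.
  set F := _ \_ `[0, 1[; set E := (fun t => (e t)%:E) \_ _.
  have mr (D : set (measurableTypeR R)) (u : R -> R) : measurable D ->
      measurable_fun setT u ->
      measurable_fun setT ((fun t : measurableTypeR R => (u t)%:E) \_ D).
    move=> mD mu'; apply/(measurable_restrictT _ mD)/measurable_EFinP.
    exact: measurable_funS mu'.
  have mF : measurable_fun setT F by exact: mr.
  have mE : measurable_fun setT E by exact: mr.
  have F0 t : (0 <= F t)%E by rewrite /F patchE; case: ifP => // _; rewrite lee_fin.
  have E0 t : (0 <= E t)%E by rewrite /E patchE; case: ifP => // _; rewrite lee_fin.
  have mF' := measurableT_comp mF (measurable_affine 2 0).
  have mE' := measurableT_comp mE (measurable_affine 2 (-1)).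
  have n2 : 2 != 0 :> R by rewrite pnatr_eq0.
  rewrite (ge0_integral_affine 0 n2 mF F0) (ge0_integral_affine (-1) n2 mE E0).
  rewrite -!ge0_integralZl// -ge0_integralD//; last 4 first.
    by move=> x _; rewrite mule_ge0.
    exact: measurable_funeM.
    by move=> x _; rewrite mule_ge0.
    exact: measurable_funeM.
  apply: eq_integral => t _; rewrite /F /E !patchE /= !mem_setE !in_itv/= /k.
  rewrite (ger0_norm (ler0n _ 2)).
  have [tl|tr] := ltP t 2^-1.
    rewrite [X in (_ + _ * X)%E]ifF ?mule0 ?adde0; last first.
      by apply/negP => /andP[]; lra.
    have -> : (0 <= 2 * t + 0 < 1) = (0 <= t <= 1).
      by apply/idP/idP => /andP[? ?]; apply/andP; split; lra.
    by case: ifP; rewrite ?mule0// EFinM.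
  rewrite [X in (_ * X + _)%E]ifF ?mule0 ?add0e; last first.
    by apply/negP => /andP[]; lra.
  have -> : (0 <= 2 * t - 1 <= 1) = (0 <= t <= 1).
    by apply/idP/idP => /andP[? ?]; apply/andP; split; lra.
  by case: ifP; rewrite ?mule0// EFinM.
have fi' : (\int[mu]_(t in `[0%R, 1%R[) (f t)%:E =
            \int[mu]_(t in `[0%R, 1%R]) (f t)%:E)%E.
  apply: integral_itv_bndo_bndc; apply/measurable_EFinP.
  exact: measurable_funS mf.
rewrite fi' in kE.
have flt : (\int[mu]_(t in `[0%R, 1%R]) (f t)%:E)%E \is a fin_num.
  exact: (integrable_fin_num m01 fi).
have elt : (\int[mu]_(t in `[0%R, 1%R]) (e t)%:E)%E \is a fin_num.
  exact: (integrable_fin_num m01 ei).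
exists k; first split => //.
- apply: ge0_integrable_unit_itv => //; rewrite kE.
  by rewrite ltey_eq fin_numD flt elt.
- have ? := ae_filter_ringOfSetsType mu.
  have n2 : 2 != 0 :> R by rewrite pnatr_eq0.
  (* The time [1/2], where the concatenation may have a corner, is discarded. *)
  apply: filterS3 (ae_neq 2^-1) (ae_affine 0 n2 gf) (ae_affine (-1) n2 he).
  move=> t t2 Hg Hh t01.
  have [tl|tr|tE] := ltgtP t 2^-1; last by rewrite tE eqxx in t2.
  + have [|v dv fE] := Hg; first lra.
    exists (2 *: v).
      apply: near_eq_is_derive (is_derive_affine dv).
      near=> s; rewrite /concat ifT//.
      have : s \in `]0, 2^-1[%R.
        by near: s; apply: near_in_itvoo; rewrite in_itv/= tl andbT; lra.
      by rewrite in_itv/= => /andP[_ /ltW].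
    by rewrite /concat /k tl (ltW tl) fE enormZ ger0_norm// mulrCA.
  + have [|v dv fE] := Hh; first lra.
    exists (2 *: v).
      apply: near_eq_is_derive (is_derive_affine dv).
      near=> s; rewrite /concat ifF//; apply/negbTE; rewrite -ltNge.
      have : s \in `]2^-1, 1[%R.
        by near: s; apply: near_in_itvoo; rewrite in_itv/= tr; lra.
      by rewrite in_itv/= => /andP[].
    by rewrite /concat /k leNgt tr /= ltNge (ltW tr) /= fE enormZ ger0_norm// mulrCA.
- by rewrite /Rintegral -fineD//; exact: (congr1 fine kE).
Unshelve. all: by end_near. Qed.
End curve_operations.

(** * The curve infimum is a metric comparable to the Euclidean one *)

Section distance.
Context {R : realType} {N : nat}.
Variables (a : 'rV[R]_N -> R) (theta Theta : R).
Hypotheses (theta0 : 0 < theta) (ca : continuous a)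
  (a_bnd : forall x, theta <= a x <= Theta).
Implicit Types (g h : R -> 'rV[R]_N) (x y z k : 'rV[R]_N).
Let mu := @lebesgue_measure R.

Lemma sqrt_dist_le_length y z g : lipschitz_curve y z g ->
  sqrt_dist a y z <= sqrt_length a g.
Proof.
move=> lg; apply: ge_inf; last by exists g.
by exists 0 => _ [h _ <-]; exact: sqrt_length_ge0.
Qed.

Definition segment y z (t : R) : 'rV[R]_N := y + t *: (z - y).

Lemma lipschitz_segment y z : lipschitz_curve y z (segment y z).
Proof.
have -> : lipschitz_curve y z = lipschitz_curve (segment y z 0) (segment y z 1).
  by rewrite /segment scale0r addr0 scale1r addrC subrK.
apply: (@bound_lipschitz_curve _ _ `|z - y|) => s t _ _.
by rewrite /segment opprD addrACA subrr add0r -scalerBl normrZ mulrC.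
Qed.

Lemma is_derive_segment y z (t : R) : is_derive t (1 : R) (segment y z) (z - y).
Proof.
apply/is_derive_rowP => i.
have -> : (fun s => segment y z s 0 i) = (fun s => y 0 i + s * (z - y) 0 i).
  by apply/funext => s; rewrite !mxE.
by apply: is_derive_eq; rewrite add0r mul1r scaler0 add0r; exact: mulr1.
Qed.

(** The segment shows that the infimum runs over a nonempty set, so it is not the default value. *)
Lemma le_sqrt_dist y z lb :
  (forall g, lipschitz_curve y z g -> lb <= sqrt_length a g) ->
  lb <= sqrt_dist a y z.
Proof.
move=> H; apply: lb_le_inf => [|_ [g lg <-]]; last exact: H.
exists (sqrt_length a (segment y z)), (segment y z) => //.
exact: lipschitz_segment.
Qed.

(** The segment is a competitor of constant Euclidean speed [|z - y|]. *)
Lemma sqrt_dist_le y z : sqrt_dist a y z <= Num.sqrt Theta * enorm (z - y).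
Proof.
have ls := lipschitz_segment y z.
apply: (le_trans (sqrt_dist_le_length ls)).
have [f sf _] := lipschitz_curve_speed theta0 ca a_bnd ls.
rewrite (sqrt_lengthE sf); have [mf f0 fi df] := sf.
have m01 := @measurable_unit_itv R.
set C := _ * _.
have C0 : 0 <= C by rewrite mulr_ge0 ?sqrtr_ge0 ?enorm_ge0.
have l1 : lebesgue_measure (`[0, 1]%classic : set R) = 1%E.
  by rewrite lebesgue_measure_itv/= lte_fin ltr01 -EFinB subr0.
have fC : (\int[mu]_(t in `[0%R, 1%R]) (f t)%:E <= C%:E)%E.
  rewrite -[leRHS]mule1 -l1 -integral_cst//.
  apply: ae_ge0_le_integral => //.
  - by move=> t _; rewrite lee_fin.
  - by apply/measurable_EFinP; exact: measurable_funS mf.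
  have ? := ae_filter_ringOfSetsType mu.
  apply: filterS3 (ae_neq 0) (ae_neq 1) df => t t0 t1 H.
  rewrite /= in_itv/= => /andP[t0' t1'].
  have [|v dv ->] := H; first by rewrite !lt_neqAle t0' t1' eq_sym t0 t1.
  have [_ dv'] := is_derive_segment y z t.
  have [_ vE] := dv; rewrite -vE dv' lee_fin /C ler_wpM2r ?enorm_ge0//.
  have /andP[a1 a2] := a_bnd (segment y z t).
  by rewrite ler_sqrt// (le_trans (ltW theta0))// (le_trans a1).
by have := fine_le (integrable_fin_num m01 fi) _ fC; apply.
Qed.

Lemma sqrt_dist_ge y z : Num.sqrt theta * enorm (z - y) <= sqrt_dist a y z.
Proof.
apply: le_sqrt_dist => g lg.
have [f sf lef] := lipschitz_curve_speed theta0 ca a_bnd lg.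
by rewrite (sqrt_lengthE sf).
Qed.

(** Curves are run backwards; exchanging [y] and [z] gives equality. *)
Lemma sqrt_dist_sym y z : sqrt_dist a z y <= sqrt_dist a y z.
Proof.
apply: le_sqrt_dist => g lg.
have [f sf _] := lipschitz_curve_speed theta0 ca a_bnd lg.
have [_ g0 g1] := lg.
have -> : sqrt_length a g = sqrt_length a (fun t => g (-1 * t + 1)).
  rewrite (sqrt_lengthE sf) (sqrt_lengthE (is_speed_reverse sf)).
  by have [mf f0 _ _] := sf; have /= := congr1 fine (integral_unit_reverse mf f0).
apply: sqrt_dist_le_length.
have [M M0 HM] := lipschitz_curve_bound lg.
have -> : lipschitz_curve z y = lipschitz_curve (g (-1 * 0 + 1)) (g (-1 * 1 + 1)).
  by rewrite mulr0 add0r g1 mulr1 addNr g0.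
apply: (@bound_lipschitz_curve _ _ M) => s t s01 t01.
have r01 (u : R) : u \in `[0, 1]%R -> -1 * u + 1 \in `[0, 1]%R.
  by rewrite !in_itv/= => /andP[? ?]; apply/andP; split; lra.
apply: (le_trans (HM _ _ (r01 _ s01) (r01 _ t01))).
by rewrite (_ : _ - _ = - (s - t)) ?normrN//; ring.
Qed.

(** Since [a] is invariant under [k], a curve and its translate have the same speed. *)
Lemma sqrt_dist_translate k y z : (forall x, a (x + k) = a x) ->
  sqrt_dist a (y + k) (z + k) <= sqrt_dist a y z.
Proof.
move=> ak; apply: le_sqrt_dist => g lg.
have [f sf _] := lipschitz_curve_speed theta0 ca a_bnd lg.
have [_ g0 g1] := lg.
have sk : is_speed a (fun t => g t + k) f.
  have [mf f0 fi df] := sf; split => //.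
  have ? := ae_filter_ringOfSetsType mu.
  apply: filterS df => t H t01; have [//|v dv ->] := H; exists v.
    by rewrite -[v]addr0; apply: is_deriveD.
  by rewrite ak.
rewrite (sqrt_lengthE sf) -(sqrt_lengthE sk); apply: sqrt_dist_le_length.
have [M M0 HM] := lipschitz_curve_bound lg.
rewrite -g0 -g1.
apply: (@bound_lipschitz_curve _ _ M (fun t => g t + k)) => s t s01 t01.
by rewrite opprD addrACA subrr addr0; exact: HM.
Qed.

Lemma lipschitz_concat x y z g h : lipschitz_curve x y g ->
  lipschitz_curve y z h -> lipschitz_curve x z (concat g h).
Proof.
move=> lg lh; have [_ g0 g1] := lg; have [_ h0 h1] := lh.
have [M M0 HM] := lipschitz_curve_bound lg.
have [L L0 HL] := lipschitz_curve_bound lh.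
have -> : lipschitz_curve x z = lipschitz_curve (concat g h 0) (concat g h 1).
  rewrite /concat ifT ?invr_ge0// ifF; last by apply/negbTE; rewrite -ltNge; lra.
  by rewrite mulr0 addr0 g0 (_ : 2 * 1 - 1 = 1) ?h1//; ring.
(* The factor 2 comes from the double speed; for times on opposite sides of [1/2] the estimate
   passes through the common point [g 1 = h 0]. *)
apply: (@bound_lipschitz_curve _ _ (2 * (M + L))) => s t.
wlog st : s t / s <= t.
  move=> H s01 t01; have [st|/ltW ts] := leP s t; first exact: H.
  by rewrite distrC (distrC s); exact: H.
rewrite !in_itv/= => /andP[s0 s1] /andP[t0 t1].
have -> : `|s - t| = t - s by rewrite distrC ger0_norm ?subr_ge0.
rewrite /concat; case: ifPn => [s2|]; case: ifPn => [t2|]; rewrite -?ltNge => *.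
- apply: (le_trans (HM _ _ _ _)); rewrite ?in_itv/=; try (apply/andP; split; lra).
  have -> : `|2 * s + 0 - (2 * t + 0)| = 2 * (t - s).
    by rewrite distrC ger0_norm; lra.
  nra.
- have h2 : `|g (2 * s + 0) - g 1| <= M * (2 * (2^-1 - s)).
    apply: (le_trans (HM _ _ _ _)); rewrite ?in_itv/=; try (apply/andP; split; lra).
    have -> : `|2 * s + 0 - 1| = 2 * (2^-1 - s) by rewrite distrC ger0_norm; lra.
    by [].
  have h3 : `|h 0 - h (2 * t + -1)| <= L * (2 * (t - 2^-1)).
    apply: (le_trans (HL _ _ _ _)); rewrite ?in_itv/=; try (apply/andP; split; lra).
    have -> : `|0 - (2 * t + -1)| = 2 * (t - 2^-1) by rewrite distrC ger0_norm; lra.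
    by [].
  have := ler_normD (g (2 * s + 0) - g 1) (h 0 - h (2 * t + -1)).
  rewrite g1 h0 subrKA => /le_trans; apply.
  rewrite g1 in h2; rewrite h0 in h3.
  apply: le_trans (lerD h2 h3) _; nra.
- lra.
- apply: (le_trans (HL _ _ _ _)); rewrite ?in_itv/=; try (apply/andP; split; lra).
  have -> : `|2 * s + -1 - (2 * t + -1)| = 2 * (t - s).
    by rewrite distrC ger0_norm; lra.
  nra.
Qed.

(** Concatenated curves compete on the left; the two infima on the right are taken one after the
    other. *)
Lemma sqrt_dist_triangle x y z :
  sqrt_dist a x z <= sqrt_dist a x y + sqrt_dist a y z.
Proof.
rewrite -lerBlDr; apply: le_sqrt_dist => g lg.
rewrite lerBlDr addrC -lerBlDr; apply: le_sqrt_dist => h lh.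
rewrite lerBlDr addrC.
have [f sf _] := lipschitz_curve_speed theta0 ca a_bnd lg.
have [e se _] := lipschitz_curve_speed theta0 ca a_bnd lh.
have [k sk kE] := is_speed_concat sf se.
rewrite (sqrt_lengthE sf) (sqrt_lengthE se) -kE -(sqrt_lengthE sk).
exact/sqrt_dist_le_length/(lipschitz_concat lg lh).
Qed.

End distance.

(** * Distance to a hyperplane for an abstract lattice-periodic metric *)

Section planar_metric.
Context {R : realType} {N : nat}.
Implicit Types (x y z w nu : 'rV[R]_N).
Variables (d : 'rV[R]_N -> 'rV[R]_N -> R) (lo hi : R).

Definition lattice_point (k : 'I_N -> int) : 'rV[R]_N := \row_i (k i)%:~R.

Hypotheses (lo0 : 0 <= lo) (hi0 : 0 <= hi)
  (d_ge : forall y z, lo * enorm (z - y) <= d y z)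
  (d_le : forall y z, d y z <= hi * enorm (z - y))
  (d_sym : forall y z, d z y <= d y z)
  (d_triangle : forall x y z, d x z <= d x y + d y z)
  (d_periodic : forall k y z,
     d (y + lattice_point k) (z + lattice_point k) <= d y z).

(** Rounding down moves each of the [N] coordinates by less than 1. *)
Lemma lattice_point_near y :
  exists k, enorm (y - lattice_point k) <= N%:R.
Proof.
exists (fun i => Num.floor (y 0 i)); apply: (le_trans (enorm_le_sum _)).
rewrite -[N in leRHS]card_ord -sumr_const; apply: ler_sum => i _.
have := floor_itv (y 0 i); rewrite !mxE intrD => /andP[? ?].
by rewrite ler_norml; apply/andP; split; lra.
Qed.

(** The cost of moving both endpoints of a path by a vector of length at most [N]. *)
Let C := hi * N%:R *+ 2.

Let C0 : 0 <= C. Proof. by rewrite mulrn_wge0// mulr_ge0. Qed.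

(** For a lattice point [p] near [y], go from [y] to [p], then to [p + w], then to [y + w]: the
    middle leg costs at most [d 0 w] by periodicity. The converse shifts back by [-p]. *)
Lemma dist_translate y w :
  d y (y + w) <= d 0 w + C /\ d 0 w <= d y (y + w) + C.
Proof.
have [k yk] := lattice_point_near y.
set p := lattice_point k in yk.
have ky : hi * enorm (y - p) <= hi * N%:R by rewrite ler_wpM2l.
have dpy u : d (p + u) (y + u) <= hi * N%:R.
  by apply: le_trans ky; rewrite (le_trans (d_le _ _))// opprD addrACA subrr addr0.
have dyp u : d (y + u) (p + u) <= hi * N%:R by exact: le_trans (dpy u).
have := dpy 0; have := dyp 0; rewrite !addr0 => dyp0 dpy0.
have := dpy w; have := dyp w => dypw dpyw.
split.
  have := d_triangle y p (y + w); have := d_triangle p (p + w) (y + w).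
  have := d_periodic k 0 w; rewrite -/p add0r addrC.
  rewrite /C mulr2n; lra.
have := d_periodic (fun i => - k i) p (p + w).
have -> : lattice_point (fun i => - k i) = - p.
  by apply/rowP => i; rewrite !mxE intrN.
rewrite subrr [p + w]addrC addrK addrC.
have := d_triangle p y (p + w); have := d_triangle y (y + w) (p + w).
rewrite /C mulr2n; lra.
Qed.

Section direction.
Variable nu : 'rV[R]_N.
Hypothesis nu1 : enorm nu = 1.

Definition level_dist (s : R) : R :=
  inf [set d 0 w | w in [set w | dot w nu = s]].

Let G := level_dist.

Let d0 y z : 0 <= d y z.
Proof. by apply: le_trans (d_ge y z); rewrite mulr_ge0 ?enorm_ge0. Qed.

Let nunu : dot nu nu = 1. Proof. by rewrite -sqr_enorm nu1 expr1n. Qed.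

Let G_le s w : dot w nu = s -> G s <= d 0 w.
Proof. by move=> ws; apply: ge_inf; [exists 0 => _ [v _ <-]|exists w]. Qed.

Let le_G s lb : (forall w, dot w nu = s -> lb <= d 0 w) -> lb <= G s.
Proof.
move=> H; apply: lb_le_inf => [|_ [w ws <-]]; last exact: H.
by exists (d 0 (s *: nu)), (s *: nu) => //=; rewrite dotZl nunu mulr1.
Qed.

Let G_lo s : lo * `|s| <= G s.
Proof.
apply: le_G => w <-; apply: le_trans (d_ge _ _); rewrite subr0 ler_wpM2l//.
by have := ler_norm_dot w nu; rewrite nu1 mulr1.
Qed.

Let G_hi s : G s <= hi * `|s|.
Proof.
apply: (@le_trans _ _ (d 0 (s *: nu))).
  by apply: G_le; rewrite dotZl nunu mulr1.
by rewrite (le_trans (d_le _ _))// subr0 enormZ nu1 mulr1.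
Qed.

Let G0 s : 0 <= G s.
Proof. by apply: le_trans (G_lo s); rewrite mulr_ge0. Qed.

(** A displacement [v] at level [s] followed by [w] at level [t] reaches level [s + t]; starting the
    second one at [v] rather than at 0 costs at most [C]. *)
Let G_add s t : G (s + t) <= G s + G t + C.
Proof.
rewrite -lerBlDr -lerBlDr; apply: le_G => v vs.
rewrite lerBlDr -lerBlDl; apply: le_G => w wt.
have H : G (s + t) <= d 0 (v + w) by apply: G_le; rewrite dotDl vs wt.
have := d_triangle 0 v (v + w); have [] := dist_translate v w.
lra.
Qed.

(** The way back from [w] to 0 is the displacement [-w] started at [w]; moving its start to 0 costs
    at most [C]. *)
Let G_opp s : G (- s) <= G s + C.
Proof.
rewrite -lerBlDr; apply: le_G => w ws; rewrite lerBlDr.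
have H : G (- s) <= d 0 (- w) by apply: G_le; rewrite dotNl ws.
have [_] := dist_translate w (- w); rewrite subrr.
have := d_sym 0 w; lra.
Qed.

Definition plane_dist y : R := inf [set d y z | z in hyperplane nu].

(** The displacements from [y] to the hyperplane are the [w] with [w.nu = - y.nu]. Moving the start
    from [y] to 0 costs one [C], and a possible change of sign of the level another. *)
Let plane_dist_level y : `|plane_dist y - G `|dot y nu| | <= C *+ 2.
Proof.
have H1 : plane_dist y <= G (- dot y nu) + C.
  rewrite -lerBlDr; apply: le_G => w ws; rewrite lerBlDr.
  have [+ _] := dist_translate y w; apply: le_trans; apply: ge_inf.
    by exists 0 => _ [v _ <-].
  by exists (y + w) => //; rewrite /hyperplane/= dotDl ws subrr.
have H2 : G (- dot y nu) <= plane_dist y + C.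
  rewrite -lerBlDr; apply: lb_le_inf => [|_ [z yz <-]].
    by exists (d y 0), 0 => //; rewrite /hyperplane/= -(subrr 0) dotBl subrr.
  have [_] := dist_translate y (z - y).
  rewrite [y + _]addrC subrK lerBlDr; apply: le_trans.
  by apply: G_le; rewrite dotBl yz sub0r.
have G1 := G_opp (dot y nu); have G2 := G_opp (- dot y nu).
rewrite opprK in G2.
rewrite ler_norml mulr2n.
by case: ger0P => _; apply/andP; split; lra.
Qed.

(** As [G + C] is subadditive, Fekete's lemma makes this infimum the limit of [G s / s]. Taking the
    infimum gives the lower bound on [G] at once. *)
Definition asymptotic_slope : R :=
  inf [set (G s + C) / s | s in [set s | 0 < s]].

Let c := asymptotic_slope.

Let c_ge : lo <= c.
Proof.
apply: lb_le_inf => [|_ [s /= s0 <-]].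
  by exists ((G 1 + C) / 1), 1 => /=.
rewrite ler_pdivlMr//; have := G_lo s; rewrite gtr0_norm//.
have := C0; lra.
Qed.

Let G_lower s : 0 <= s -> c * s <= G s + C.
Proof.
rewrite le_eqVlt => /predU1P[<-|s0]; first by rewrite mulr0 addr_ge0.
rewrite -ler_pdivlMr//; apply: ge_inf; last by exists s.
by exists 0 => _ [t /= t0 <-]; exact: (divr_ge0 (addr_ge0 (G0 t) C0) (ltW t0)).
Qed.

Let c_le : c <= hi.
Proof.
apply/ler_addgt0Pr => e e0.
(* At this [s] one has [e * s = C + 1], which absorbs the constant in [c * s <= hi * s + C]. *)
have s0 : 0 < (C + 1) / e by rewrite divr_gt0// ltr_wpDl.
have := G_lower (ltW s0); have := G_hi ((C + 1) / e).
rewrite gtr0_norm// => H1 H2; rewrite -(ler_pM2r s0) [leRHS]mulrDl.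
have -> : e * ((C + 1) / e) = C + 1 by rewrite mulrC divfK// gt_eqF.
lra.
Qed.

(* Fekete's argument: compare [s] with the multiple of [s0] just below it. *)
Let G_upper e : 0 < e -> exists M, forall s, 0 <= s -> G s <= (c + e) * s + M.
Proof.
move=> e0.
have [_ [s0 /= s00 <-] Hs0] : exists2 r,
    [set (G s + C) / s | s in [set s | 0 < s]] r & r < c + e.
  apply: inf_adherent => //; split.
    by exists ((G 1 + C) / 1), 1 => /=.
  by exists 0 => _ [t /= t0 <-]; exact: (divr_ge0 (addr_ge0 (G0 t) C0) (ltW t0)).
rewrite ltr_pdivrMr// in Hs0.
(* Each step of length [s0] costs at most [G s0 + C], which is less than [(c + e) * s0] by the
   choice of [s0]. *)
have ind n r : G (n%:R * s0 + r) <= n%:R * ((c + e) * s0) + G r.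
  elim: n => [|n IH]; first by rewrite !mul0r !add0r.
  rewrite -natr1 !mulrDl !mul1r.
  have := G_add s0 (n%:R * s0 + r).
  have -> : s0 + (n%:R * s0 + r) = n%:R * s0 + s0 + r by ring.
  lra.
(* This bounds [G] at the remainder, which lies between 0 and [s0]. *)
exists (hi * s0) => s s_ge0.
have ce0 : 0 <= c + e by rewrite addr_ge0 ?(ltW e0)// (le_trans lo0).
pose n := Num.truncn (s / s0).
have /andP[n1 n2] := truncn_itv (divr_ge0 s_ge0 (ltW s00)).
rewrite -/n ler_pdivlMr// in n1; rewrite -/n ltr_pdivrMr// in n2.
have := ind n (s - n%:R * s0); rewrite addrC subrK => /le_trans; apply.
apply: lerD.
  by rewrite mulrCA ler_wpM2l.
apply: (le_trans (G_hi _)); rewrite ler_wpM2l// ger0_norm ?subr_ge0//.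
by rewrite -natr1 mulrDl mul1r in n2; lra.
Qed.

Lemma plane_dist_asymptotic e : 0 < e -> exists2 M, 0 <= M & forall y,
  `|Num.sg (dot y nu) * plane_dist y - c * dot y nu| <= e * `|dot y nu| + M.
Proof.
move=> e0; have [M HM] := G_upper e0.
(* Two [C] come from replacing the distance to the plane by [G], the third from the lower bound on
   [G], and [M] from the upper bound. *)
exists (`|M| + C *+ 3) => [|y]; first by rewrite addr_ge0// mulrn_wge0.
have -> : `|Num.sg (dot y nu) * plane_dist y - c * dot y nu| =
          `|Num.sg (dot y nu)| * `|plane_dist y - c * `|dot y nu| |.
  by rewrite -normrM mulrBr mulrCA -numEsg.
(* Only an inequality, because the sign is 0 on the hyperplane. *)
apply: (@le_trans _ _ `|plane_dist y - c * `|dot y nu| |).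
  by rewrite ler_piMl// normr_sg lern1 leq_b1.
have := plane_dist_level y; have := G_lower (normr_ge0 (dot y nu)).
have := HM _ (normr_ge0 (dot y nu)); have := ler_norm M; have := C0.
rewrite !ler_norml !mulrS mulr0n => ? ? ? ? /andP[? ?].
have ? : 0 <= `|M| by [].
have ? : 0 <= e * `|dot y nu| by rewrite mulr_ge0// ltW.
apply/andP; split; lra.
Qed.

Lemma asymptotic_slope_bound : lo <= c <= hi.
Proof. by rewrite c_ge c_le. Qed.

End direction.
End planar_metric.

(** * From sublinear error to the locally uniform limit *)

Section planar_limits.
Context {R : realType} {N : nat}.
Variables (a : 'rV[R]_N -> R).
Implicit Types (x y z nu : 'rV[R]_N) (c : R).

(** At [y = T x], division by [T] leaves the error [e |x.nu| + M / T], and [|x.nu|] is bounded on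
    [K]. *)
Lemma planar_limit_of_sublinear_error nu c :
  (forall e, 0 < e -> exists2 M, 0 <= M & forall y,
    `|signed_dist a nu y - c * dot y nu| <= e * `|dot y nu| + M) ->
  planar_limit a nu c.
Proof.
move=> H K cK.
have [B B0 HB] : exists2 B, 0 < B & forall x, K x -> `|dot x nu| <= B.
  have [L [_ HL]] := compact_bounded cK.
  (* The first factor bounds the sup norm on [K], the second the sum of the [|nu_i|]; adding 1 makes
     both positive. *)
  exists ((`|L| + 1) * (\sum_(i < N) `|nu 0 i| + 1)) => [|x Kx].
    by rewrite mulr_gt0// ltr_wpDl// sumr_ge0.
  have xL : `|x| <= `|L| + 1.
    by apply: (HL (`|L| + 1)) => //; rewrite (le_lt_trans (ler_norm L))// ltrDl.
  apply: (le_trans (ler_norm_sum _ _ _)).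
  apply: (@le_trans _ _ ((`|L| + 1) * \sum_(i < N) `|nu 0 i|)).
    rewrite mulr_sumr; apply: ler_sum => i _; rewrite normrM ler_wpM2r//.
    exact: le_trans (ler_entry_norm x i) xL.
  by rewrite ler_wpM2l ?lerDl// addr_ge0.
apply/cvgrPdist_le => e e0.
(* With this slope the linear term contributes at most [e / 2] after rescaling; large [T] makes
   [M / T] at most [e / 2]. *)
have [M M0 HM] := H (e / 2 / B) (divr_gt0 (divr_gt0 e0 (ltr0n _ 2)) B0).
near=> T.
have T0 : 0 < T by near: T; apply: nbhs_pinfty_gt; exact: num_real.
have TM : M <= T * (e / 2).
  rewrite -ler_pdivrMr; last by rewrite divr_gt0.
  by near: T; apply: nbhs_pinfty_ge; exact: num_real.
have KT x : K x -> `|T^-1 * signed_dist a nu (T *: x) - c * dot x nu| <= e.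
  move=> Kx; rewrite -(ler_pM2l T0).
  rewrite -[X in X * `|_|](gtr0_norm T0) -normrM mulrBr mulrA divff ?gt_eqF// mul1r.
  rewrite mulrCA -dotZl; apply: (le_trans (HM _)).
  rewrite dotZl normrM (gtr0_norm T0).
  have : e / 2 / B * (T * `|dot x nu|) <= T * (e / 2).
    have -> : e / 2 / B * (T * `|dot x nu|) = T * (e / 2) * (`|dot x nu| / B).
      by field; rewrite gt_eqF.
    rewrite ler_piMr//; first by rewrite mulr_ge0// ?ltW// divr_gt0.
    by rewrite ler_pdivrMr// mul1r HB.
  have -> : T * e = T * (e / 2) + T * (e / 2) by field.
  lra.
rewrite sub0r normrN.
(* For empty [K] the supremum takes its default value 0. *)
have [->|/set0P[x Kx]] := eqVneq K set0; first by rewrite image_set0 sup0 normr0 ltW.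
have KTub : ubound
    [set `|T^-1 * signed_dist a nu (T *: x) - c * dot x nu| | x in K] e.
  by move=> _ [y Ky <-]; exact: KT.
rewrite ger0_norm; first by apply: ge_sup => //; eexists; exists x.
apply: (@le_trans _ _ (`|T^-1 * signed_dist a nu (T *: x) - c * dot x nu|)) => //.
by apply: ub_le_sup; [exists e|exists x].
Unshelve. all: by end_near. Qed.

(** On [K = {nu}] the limit says that the rescaled distance at [T nu] tends to the slope, because
    [nu.nu = 1]. *)
Lemma planar_limit_unique nu s t : dot nu nu = 1 ->
  planar_limit a nu s -> planar_limit a nu t -> s = t.
Proof.
move=> nu1 Hs Ht.
have cvg u : planar_limit a nu u ->
    T^-1 * signed_dist a nu (T *: nu) @[T --> +oo] --> u.
  move=> /(_ [set nu] (@compact_set1 _ nu)).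
  under eq_fun do rewrite image_set1 sup1 nu1 mulr1.
  by move=> /norm_cvg0 /subr_cvg0.
rewrite -(cvg_lim (@Rhausdorff R) (cvg _ Hs)).
exact: (cvg_lim (@Rhausdorff R) (cvg _ Ht)).
Qed.

Lemma signed_distN nu y : signed_dist a (- nu) y = - signed_dist a nu y.
Proof.
rewrite /signed_dist dotNr sgrN mulNr; congr (- (_ * inf _)).
have -> // : hyperplane (- nu) = hyperplane nu.
apply/seteqP; split => z; rewrite /hyperplane/= dotNr; last by move=> ->; rewrite oppr0.
by move=> /eqP; rewrite oppr_eq0 => /eqP.
Qed.

Lemma planar_limitN nu c : planar_limit a nu c -> planar_limit a (- nu) c.
Proof.
move=> H K cK; under eq_fun => T.
  rewrite (_ : [set _ | _ in K] =
    [set `|T^-1 * signed_dist a nu (T *: x) - c * dot x nu| | x in K]).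
    over.
  apply: eq_imagel => x _.
  by rewrite signed_distN dotNr !mulrN -opprD normrN.
exact: H.
Qed.

(** A lattice vector is a sum of integer multiples of basis vectors, which are removed one at a
    time. *)
Lemma Zperiodic_lattice_point k x : Zperiodic a -> a (x + lattice_point k) = a x.
Proof.
move=> pa.
have -> : lattice_point k = \sum_(i < N) (k i)%:~R *: (delta_mx 0 i : 'rV[R]_N).
  rewrite [LHS]row_sum_delta; by apply: eq_bigr => i _; rewrite mxE.
elim/big_rec: _ x => [x|i y _ IH x]; first by rewrite addr0.
by rewrite addrA IH.
Qed.

End planar_limits.

(** * Existence, uniqueness and evenness of the slope *)

Unset Implicit Arguments.

Theorem theorem1p4 (R : realType) (N : nat) (a : 'rV[R]_N -> R)
    (theta Theta : R) :
  (2 <= N)%N ->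
  0 < theta -> theta < Theta ->
  continuous a ->
  (forall x, 0 < a x) ->
  Zperiodic a ->
  (forall x, theta <= a x <= Theta) ->
  exists c : 'rV[R]_N -> R, forall nu, unit_sphere nu ->
    unique (fun s : R => Num.sqrt theta <= s <= Num.sqrt Theta /\
                         planar_limit a nu s) (c nu)
    /\ c nu = c (- nu).
Proof.
move=> _ theta0 _ ca _ pa a_bnd.
have dge := sqrt_dist_ge theta0 ca a_bnd.
have dle := sqrt_dist_le theta0 ca a_bnd.
have dsym := sqrt_dist_sym theta0 ca a_bnd.
have dtri := sqrt_dist_triangle theta0 ca a_bnd.
have dper k y z := sqrt_dist_translate theta0 ca a_bnd y z
  (fun x => Zperiodic_lattice_point k x pa).
(* The abstract results are used with [lo = sqrt theta] and [hi = sqrt Theta]. *)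
pose c nu := asymptotic_slope (sqrt_dist a) (Num.sqrt Theta) nu.
have cP nu : enorm nu = 1 ->
    Num.sqrt theta <= c nu <= Num.sqrt Theta /\ planar_limit a nu (c nu).
  move=> nu1; split.
    exact: (asymptotic_slope_bound (sqrtr_ge0 _) (sqrtr_ge0 _) dge dle nu1).
  apply: planar_limit_of_sublinear_error.
  exact: (plane_dist_asymptotic (sqrtr_ge0 _) (sqrtr_ge0 _)
    dge dle dsym dtri dper nu1).
have dot1 (nu : 'rV[R]_N) : enorm nu = 1 -> dot nu nu = 1.
  by move=> nu1; rewrite -sqr_enorm nu1 expr1n.
exists c => nu nu1; have [cb cl] := cP nu nu1.
split; first by split => // s [_ /(planar_limit_unique (dot1 _ nu1) cl)].
have nuN1 : enorm (- nu) = 1 by rewrite enormN.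
have [_ clN] := cP _ nuN1.
(* Reversing [nu] changes the sign of both terms of the difference, so [c nu] is also a slope for
   [- nu], and uniqueness applies. *)
exact: (planar_limit_unique (dot1 _ nuN1) (planar_limitN cl) clN).
Qed.
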